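(* Let $q$ be a prime and $n\ge 0$ an integer. Let $N(n)$ be the number of isomorphism classes of pointed abelian groups $(A,c)$ with $|A|=q^n$. Then \[N(n)=\sum_{0\le m\le n}p(m)p(n-m),\] where $p(m)$ is the number of partitions of the integer $m$ (with $p(0)=1$). Equivalently, $N(n)$ equals the number of partitions of $n$ into parts of two kinds, i.e. $\sum_{n\ge0}N(n)x^n=\prod_{m\ge1}(1-x^m)^{-2}$.
   Context: A pointed abelian group is a pair $(A,c)$ where $A$ is an abelian group and $c\in A$. Two pointed abelian groups $(A,c)$ and $(A',c')$ are isomorphic if there is a group isomorphism $f:A\to A'$ with $f(c)=c'$. *)

(* Defs.v *)
From mathcomp Require Import all_boot all_order all_algebra.
Set Implicit Arguments. Unset Strict Implicit. Unset Printing Implicit Defensive.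
Import GRing.Theory.
Local Open Scope ring_scope.

Record pointed_group := PointedGroup {
  pg_carrier : finZmodType;
  pg_point : pg_carrier
}.

Definition pointed_iso (P Q : pointed_group) : Prop :=
  exists f : pg_carrier P -> pg_carrier Q,
    (forall x y, f (x + y) = f x + f y) /\ bijective f /\ f (pg_point P) = pg_point Q.

(* Number of partitions of m: nonincreasing sequences of positive integers
   summing to m, encoded as nonincreasing m-tuples with entries in [0,m]
   (padded with zeros) summing to m. *)
Definition npartitions (m : nat) : nat :=
  #|[set s : m.-tuple 'I_m.+1 |
      sorted geq (map val s) && (sumn (map val s) == m)]|.

(* Main.v *)
From HB Require Import structures.
Require Import Defs.
From mathcomp Require Import all_boot all_order all_algebra.
From mathcomp Require Import all_fingroup all_solvable zify.

(** Every pointed abelian group of order [q^n] is isomorphic to exactly one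
    [(\prod_i Z/q^(mu_i + nu_i), (q^(nu_i))_i)] with [mu], [nu] nonincreasing, that
    is, with [(mu, nu)] a pair of partitions of total size [n].

    Existence: write [c = \sum_i q^(a_i) e_i] for a decomposition of [A] into cyclic
    groups [<e_i>] of order [q^(l_i)].  If the pairs [(a_i, l_i - a_i)] do not form a
    chain for the product order, a change of generators lowers [\sum_i a_i]; once
    they form a chain, sort them.

    Uniqueness: the cardinals of the [q^k]-torsion subgroups determine
    [mu_i + nu_i], and [c] lies in [q^k A + A[q^m]] iff every [i] satisfies
    [k <= nu_i] or [mu_i <= m], which for a given [mu + nu] determines [(mu, nu)]. *)

Set Implicit Arguments. Unset Strict Implicit. Unset Printing Implicit Defensive.
Import GRing.Theory.
Local Open Scope ring_scope.

(** * Finite products of cyclic groups *)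

Section CyclicProduct.
Variables (I : finType) (d : I -> nat).

(** The factor at [i] is the cyclic group of order [d i + 1]: ordinals form an additive group only
    when their bound is visibly a successor. Cyclic groups of order [q ^ l] thus appear with
    [d i = (q ^ l).-1]. *)
Definition cycprod := {dffun forall i : I, 'I_(d i).+1}.
HB.instance Definition _ := Finite.on cycprod.

Definition cycprod_zero : cycprod := [ffun i => 0].
Definition cycprod_opp (x : cycprod) : cycprod := [ffun i => - x i].
Definition cycprod_add (x y : cycprod) : cycprod := [ffun i => x i + y i].

Fact cycprod_addA : associative cycprod_add.
Proof. by move=> x y z; apply/ffunP => i; rewrite !ffunE addrA. Qed.
Fact cycprod_addC : commutative cycprod_add.
Proof. by move=> x y; apply/ffunP => i; rewrite !ffunE addrC. Qed.
Fact cycprod_add0 : left_id cycprod_zero cycprod_add.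
Proof. by move=> x; apply/ffunP => i; rewrite !ffunE add0r. Qed.
Fact cycprod_addN : left_inverse cycprod_zero cycprod_opp cycprod_add.
Proof. by move=> x; apply/ffunP => i; rewrite !ffunE addNr. Qed.

HB.instance Definition _ := GRing.isZmodule.Build cycprod
  cycprod_addA cycprod_addC cycprod_add0 cycprod_addN.

Lemma cycprodMn (x : cycprod) k i : (x *+ k) i = x i *+ k.
Proof.
elim: k => [|k IHk]; first by rewrite !mulr0n ffunE.
by rewrite !mulrS ffunE IHk.
Qed.

Lemma card_cycprod : #|cycprod| = (\prod_i (d i).+1)%N.
Proof.
rewrite card_dep_ffun foldrE big_map big_enum.
by apply: eq_bigr => i _; rewrite card_ord.
Qed.

Lemma card_cycprod_tors k :
  #|[set x : cycprod | x *+ k == 0]| =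
  (\prod_i #|[set y : 'I_(d i).+1 | (y *+ k == 0)%R]|)%N.
Proof.
pose F i : pred 'I_(d i).+1 := mem [set y : 'I_(d i).+1 | y *+ k == 0].
have /esym := card_family F; rewrite foldrE big_map big_enum /= => ->.
apply: eq_card => x; rewrite inE; apply/eqP/familyP => [xk0 i | xk0].
  by rewrite !inE -cycprodMn xk0 ffunE.
apply/ffunP => i; rewrite cycprodMn ffunE.
by have := xk0 i; rewrite !inE => /eqP.
Qed.

End CyclicProduct.

(** * Isomorphism invariants of products of cyclic [q]-groups *)

Lemma Zp_mulrn_eq0 d (y : 'I_d.+1) k : (y *+ k == 0) = (d.+1 %| y * k)%N.
Proof. by rewrite Zp_mulrn -val_eqE. Qed.

Lemma expn_predK q k : (0 < q)%N -> (q ^ k).-1.+1 = (q ^ k)%N.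
Proof. by move=> q_gt0; rewrite prednK // expn_gt0 q_gt0. Qed.

Lemma morph_mulrn (A B : zmodType) (f : A -> B) :
  {morph f : x y / x + y} -> forall x k, f (x *+ k) = f x *+ k.
Proof.
move=> fD x; elim=> [|k IH]; last by rewrite !mulrS fD IH.
by rewrite !mulr0n; apply: (addrI (f 0)); rewrite -fD !addr0.
Qed.

Section PrimePower.
Variables (q : nat) (hq : prime q).

Let q_gt0 : (0 < q)%N := prime_gt0 hq.
Let q_gt1 : (1 < q)%N := prime_gt1 hq.
Let predK k := expn_predK k q_gt0.

Lemma card_Zp_tors l k :
  #|[set y : 'I_(q ^ l).-1.+1 | y *+ q ^ k == 0]| = (q ^ minn l k)%N.
Proof.
(* The torsion consists of the multiples of [q ^ (l - k)]; truncated subtraction also covers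
   [l <= k], where every element is torsion. *)
pose f (j : 'I_(q ^ minn l k)) : 'I_(q ^ l).-1.+1 := inZp (q ^ (l - k) * j)%N.
have qsplit : (q ^ l = q ^ (l - k) * q ^ minn l k)%N by rewrite -expnD; congr expn; lia.
have fE j : f j = (q ^ (l - k) * j)%N :> nat.
  rewrite /= predK modn_small // qsplit ltn_mul2l expn_gt0 q_gt0 /=; exact: ltn_ord.
have f_inj : injective f.
  move=> i j /(congr1 (@nat_of_ord _)); rewrite !fE => /eqP.
  by rewrite eqn_pmul2l ?expn_gt0 ?q_gt0 // => /eqP/val_inj.
rewrite -[RHS]card_ord -(card_codom f_inj); apply: eq_card => y.
rewrite inE Zp_mulrn_eq0 [X in (X %| _)%N]predK; apply/idP/codomP => [dv | [j ->]].
  have : (q ^ (l - k) %| y)%N.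
    have [lk|kl] := leqP l k; first by rewrite (eqP lk) expn0 dvd1n.
    by rewrite -(@dvdn_pmul2r (q ^ k)) ?expn_gt0 ?q_gt0 // -expnD subnK // ltnW.
  case/dvdnP => j yE.
  have jlt : (j < q ^ minn l k)%N.
    rewrite -(@ltn_pmul2r (q ^ (l - k))) ?expn_gt0 ?q_gt0 // -yE [X in (_ < X)%N]mulnC.
    by rewrite -qsplit -[X in (_ < X)%N]predK ltn_ord.
  by exists (Ordinal jlt); apply: ord_inj; rewrite fE yE mulnC.
rewrite fE mulnAC -expnD dvdn_mulr // dvdn_exp2l //; lia.
Qed.

(* [c] has this property iff it lies in [q^k A + A[q^m]]. *)
Definition height_tors (A : finZmodType) (c : A) k m :=
  exists a : A, c *+ q ^ m = a *+ q ^ (k + m).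

Lemma height_tors_Zp l t k m :
  (exists a : 'I_(q ^ l).-1.+1, inZp (q ^ t) *+ q ^ m = a *+ q ^ (k + m)) <->
  (k <= t)%N || (l <= t + m)%N.
Proof.
split=> [[a] | /orP[kt | lt]]; last 2 first.
- exists (inZp (q ^ (t - k))); rewrite !Zp_mulrn; apply: val_inj => /=.
  by rewrite !modnMml -!expnD; congr (_ ^ _ %% _)%N; lia.
- exists 0; rewrite mul0rn; apply/eqP; rewrite Zp_mulrn_eq0 /= predK.
  by rewrite /dvdn modnMml -expnD -/(dvdn _ _) dvdn_exp2l.
rewrite !Zp_mulrn => /(congr1 val) /= /eqP; rewrite modnMml.
move: (nat_of_ord a) => {}a; rewrite predK -expnD => Hmod.
have [//|tk /=] := leqP k t; rewrite leqNgt; apply/negP => tml.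
(* With [t < k] and [t + m < l], reduction modulo [q ^ (t + m).+1] is legitimate; it kills the
   multiple of [q ^ (k + m)] but not [q ^ (t + m)]. *)
have dvl : (q ^ (t + m).+1 %| q ^ l)%N by apply: dvdn_exp2l.
have : (q ^ (t + m).+1 %| q ^ (t + m))%N.
  have := congr1 (fun x => x %% q ^ (t + m).+1)%N (eqP Hmod).
  rewrite /= !modn_dvdm // /dvdn => ->; apply: dvdn_mull.
  by apply: dvdn_exp2l; rewrite -addSn leq_add2r.
by rewrite dvdn_Pexp2l // ltnn.
Qed.

Definition bipart_group n (mu nu : 'I_n -> nat) : pointed_group :=
  @PointedGroup (cycprod (fun i => (q ^ (mu i + nu i)).-1))
    [ffun i => inZp (q ^ nu i)].

Lemma card_bipart_group n (mu nu : 'I_n -> nat) :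
  #|pg_carrier (bipart_group mu nu)| = (q ^ \sum_i (mu i + nu i))%N.
Proof.
by rewrite card_cycprod expn_sum; apply: eq_bigr => i _; rewrite predK.
Qed.

Lemma card_bipart_tors n (mu nu : 'I_n -> nat) k :
  #|[set x : pg_carrier (bipart_group mu nu) | x *+ q ^ k == 0]| =
  (q ^ \sum_i minn (mu i + nu i) k)%N.
Proof.
by rewrite card_cycprod_tors expn_sum; apply: eq_bigr => i _; rewrite card_Zp_tors.
Qed.

Lemma height_tors_bipart n (mu nu : 'I_n -> nat) k m :
  height_tors (pg_point (bipart_group mu nu)) k m <->
  forall i, (k <= nu i)%N || (mu i <= m)%N.
Proof.
have E i : (k <= nu i)%N || (mu i <= m)%N = (k <= nu i)%N || (mu i + nu i <= nu i + m)%N.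
  by rewrite addnC leq_add2l.
split=> [[a aE] i | H].
  rewrite E -height_tors_Zp; exists (a i).
  by move/ffunP/(_ i): aE; rewrite !cycprodMn ffunE.
have {}H i : exists a : 'I_(q ^ (mu i + nu i)).-1.+1,
    inZp (q ^ nu i) *+ q ^ m == a *+ q ^ (k + m).
  have := H i; rewrite E -height_tors_Zp => -[a aE]; by exists a; apply/eqP.
exists ([ffun i => xchoose (H i)] : cycprod _); apply/ffunP => i.
by rewrite !cycprodMn !ffunE; apply/eqP; exact: (xchooseP (H i)).
Qed.

Lemma height_tors_iso (P Q : pointed_group) k m :
  pointed_iso P Q -> height_tors (pg_point P) k m -> height_tors (pg_point Q) k m.
Proof.
case=> f [fD [_ <-]] [a aE].
by exists (f a); rewrite -!(morph_mulrn fD) aE.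
Qed.

Lemma pointed_iso_sym (P Q : pointed_group) : pointed_iso P Q -> pointed_iso Q P.
Proof.
case=> f [fD [[g fK gK] fc]]; exists g; split; last first.
  by split; [exists f | rewrite -fc fK].
by move=> x y; apply: (can_inj fK); rewrite fD !gK.
Qed.

Lemma card_tors_iso (P Q : pointed_group) k : pointed_iso P Q ->
  #|[set x : pg_carrier P | x *+ k == 0]| = #|[set x : pg_carrier Q | x *+ k == 0]|.
Proof.
case=> f [fD [[g fK gK] _]].
have f0 : f 0 = 0 := morph_mulrn fD 0 0.
rewrite -(card_imset _ (can_inj fK)); apply: eq_card => y; rewrite !inE.
apply/imsetP/idP => [[x]|yk].
  by rewrite inE => /eqP xk ->; rewrite -(morph_mulrn fD) xk f0.
exists (g y); rewrite ?gK // inE; apply/eqP/(can_inj fK).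
by rewrite (morph_mulrn fD) gK f0; apply/eqP.
Qed.

End PrimePower.

(** * Uniqueness of the pair of partitions *)

Definition nonincr n (a : 'I_n -> nat) := forall i j : 'I_n, (i <= j)%N -> (a j <= a i)%N.

(** The increments of these sums are the parts of the conjugate partition, so torsion cardinals give
    access to the latter. *)
Lemma sum_minnS n (l : 'I_n -> nat) k :
  (\sum_i minn (l i) k.+1 = \sum_i minn (l i) k + #|[set i | (k < l i)%N]|)%N.
Proof.
rewrite -sum1_card [X in (_ + X)%N]big_mkcond -big_split /=.
by apply: eq_bigr => i _; rewrite inE; case: ltnP; lia.
Qed.

Lemma nonincr_eq n (l l' : 'I_n -> nat) : nonincr l -> nonincr l' ->
  (forall k, \sum_i minn (l i) k = \sum_i minn (l' i) k)%N -> l =1 l'.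
Proof.
move=> dl dl' eqS.
have eqc k : #|[set i | (k < l i)%N]| = #|[set i | (k < l' i)%N]|.
  by have := eqS k.+1; rewrite !sum_minnS eqS => /addnI.
suff le (f g : 'I_n -> nat) : nonincr f -> nonincr g ->
    (forall k, #|[set i | (k < f i)%N]| = #|[set i | (k < g i)%N]|) ->
    forall i, (g i <= f i)%N.
  by move=> i; apply/eqP; rewrite eqn_leq !le.
move=> df dg eqfg i.
rewrite leqNgt; apply/negP => lt_fg.
(* By monotonicity [f i < f j] forces [j < i], hence [f i < g i <= g j]; the index [i] itself lies
   only in the second set, contradicting equal counts. *)
have : [set j | (f i < f j)%N] \proper [set j | (f i < g j)%N].
  apply/properP; split; last by exists i; rewrite inE ?ltnn.
  apply/subsetP => j; rewrite !inE => fij.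
  apply: leq_trans lt_fg (dg _ _ _); rewrite leqNgt; apply/negP => /ltnW/df.
  by rewrite leqNgt fij.
by move/proper_card; rewrite eqfg ltnn.
Qed.

Lemma bipart_group_inj q n (mu nu mu' nu' : 'I_n -> nat) : prime q ->
  nonincr mu -> nonincr nu -> nonincr mu' -> nonincr nu' ->
  pointed_iso (bipart_group q mu nu) (bipart_group q mu' nu') ->
  mu =1 mu' /\ nu =1 nu'.
Proof.
move=> hq dmu dnu dmu' dnu' iso.
have eql : (fun i => mu i + nu i)%N =1 (fun i => mu' i + nu' i)%N.
  apply: nonincr_eq; [by move=> i j ij; rewrite leq_add ?dmu ?dnu
                     |by move=> i j ij; rewrite leq_add ?dmu' ?dnu' |].
  move=> k; have := card_tors_iso (q ^ k) iso; rewrite !card_bipart_tors //.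
  by move/eqP; rewrite eqn_exp2l ?prime_gt1 // => /eqP.
have eqJ k m : (forall i, (k <= nu i)%N || (mu i <= m)%N) <->
               (forall i, (k <= nu' i)%N || (mu' i <= m)%N).
  rewrite -!(height_tors_bipart hq).
  by split; apply: height_tors_iso => //; apply: pointed_iso_sym.
suff le (f g f' g' : 'I_n -> nat) : nonincr f' -> nonincr g' ->
    (forall i, f i + g i = f' i + g' i)%N ->
    (forall k m, (forall i, (k <= g' i)%N || (f' i <= m)%N) ->
                 (forall i, (k <= g i)%N || (f i <= m)%N)) ->
    forall i : 'I_n, (f i <= f' i)%N.
  have eqmu : mu =1 mu'.
    move=> i; apply/eqP; rewrite eqn_leq; apply/andP; split.
      by apply: (le _ nu _ nu') => // k m; apply: (proj2 (eqJ k m)).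
    by apply: (le _ nu' _ nu) => // k m; apply: (proj1 (eqJ k m)).
  by split=> // i; have := eql i; rewrite eqmu => /addnI.
move=> df' dg' eqs H i; rewrite leqNgt; apply/negP => lt.
(* The test pair [(g' i, f' i)] is passed by [(f', g')]: indices after [i] satisfy the second
   alternative, those before it the first. At [i], both alternatives for [(f, g)] contradict
   [f' i < f i], as [f + g = f' + g']. *)
have /(_ i) : forall j, (g' i <= g j)%N || (f j <= f' i)%N.
  apply: H => j; case: (leqP i j) => [ij|/ltnW ji]; first by rewrite df' ?orbT.
  by rewrite dg'.
by have := eqs i; lia.
Qed.

(** * Existence: generators adapted to the marked point *)

Section ZmodClosed.
Variables (A : zmodType) (S : {pred A}) (clS : zmod_closed S).

Lemma closedB x y : x \in S -> y \in S -> x - y \in S.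
Proof. by case: clS => _; apply. Qed.

Lemma closedD x y : x \in S -> y \in S -> x + y \in S.
Proof. by case: (GRing.zmod_closedD clS) => _; apply. Qed.

Lemma closedMn x k : x \in S -> x *+ k \in S.
Proof.
by case: clS => S0 _ Sx; elim: k => [|k IH]; rewrite ?mulr0n // mulrS closedD.
Qed.
End ZmodClosed.

Lemma mulrn_modn (A : zmodType) (x : A) d k : x *+ d = 0 -> x *+ (k %% d) = x *+ k.
Proof.
by move=> xd; rewrite [in RHS](divn_eq k d) mulrnDr mulnC mulrnA xd mul0rn add0r.
Qed.

Section Generators.
Variables (q : nat) (hq : prime q) (A : finZmodType) (n : nat).
Implicit Types (l a : 'I_n -> nat) (e : 'I_n -> A).

Let q_gt0 : (0 < q)%N := prime_gt0 hq.
Let predK k := expn_predK k q_gt0.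

(* Not required to be independent, so that changes of generators only have to
   preserve the span: independence comes from [#|A| = q ^ \sum_i l i]. *)
Definition gen_system l e :=
  (forall i, e i *+ q ^ l i = 0) /\
  (forall S : {set A}, zmod_closed S -> (forall i, e i \in S) -> forall x, x \in S).

Definition lincomb l e (x : cycprod (fun i => (q ^ l i).-1)) : A :=
  \sum_i e i *+ x i.

(** Coefficients are added modulo [q ^ l i], which is harmless because [q ^ l i] kills [e i]. *)
Lemma lincombD l e : gen_system l e -> {morph @lincomb l e : x y / x + y}.
Proof.
case=> el _ x y; rewrite /lincomb -big_split; apply: eq_bigr => i _ /=.
by rewrite ffunE /= mulrn_modn ?mulrnDr // predK.
Qed.

Lemma lincomb_surj l e : gen_system l e -> forall c, exists x, @lincomb l e x = c.
Proof.
move=> gen c; case: (gen) => el span.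
have h0 : @lincomb l e 0 = 0.
  by apply: (addrI (@lincomb l e 0)); rewrite -lincombD // !addr0.
suff : c \in [set @lincomb l e x | x in setT] by case/imsetP => x _ ->; exists x.
apply: span => [|i]; first split.
- by apply/imsetP; exists 0; rewrite ?inE.
- move=> _ _ /imsetP[x _ ->] /imsetP[y _ ->]; apply/imsetP; exists (x - y) => //.
  by apply: (addIr (@lincomb l e y)); rewrite -lincombD // !subrK.
apply/imsetP; exists [ffun j => inZp (j == i)] => //.
rewrite /lincomb (bigD1 i) //= big1 ?addr0 => [|j ji].
  by rewrite ffunE /= eqxx mulrn_modn // predK.
by rewrite ffunE /= (negPf ji) mod0n.
Qed.

(** The linear combination map is onto, so a section of it is injective; equal cardinals make the
    section bijective, and it is the required isomorphism. *)
Lemma gen_system_iso (mu nu : 'I_n -> nat) e c :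
  #|A| = (q ^ \sum_i (mu i + nu i))%N -> gen_system (fun i => mu i + nu i)%N e ->
  c = \sum_i e i *+ q ^ nu i ->
  pointed_iso (PointedGroup c) (bipart_group q mu nu).
Proof.
move=> cardA gen cE; pose l i := (mu i + nu i)%N.
have [h hK] := fin_all_exists (lincomb_surj gen).
have h_bij : bijective h.
  by apply: (inj_card_bij (can_inj hK)); rewrite cardA -(card_bipart_group hq mu nu).
have gK : cancel (@lincomb l e) h by apply/bij_can_sym.
exists h; split=> [x y | ]; first by apply: (can_inj gK); rewrite lincombD // !hK.
split=> //=; apply: (can_inj gK); rewrite hK cE; apply: eq_bigr => i _.
by rewrite ffunE /= mulrn_modn // predK; case: gen.
Qed.

(** Each coefficient of [c] is a power of [q] times a number prime to [q]; the latter is absorbed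
    into the generator. *)
Lemma scale_gen_system l e c : gen_system l e ->
  exists e' a, [/\ gen_system l e', forall i, (a i <= l i)%N
    & c = \sum_i e' i *+ q ^ a i].
Proof.
move=> gen; have [x xE] := lincomb_surj gen c; case: (gen) => el span.
have H i : exists au : nat * nat, [/\ (au.1 <= l i)%N, coprime au.2 q
    & e i *+ x i = e i *+ au.2 *+ q ^ au.1].
  have [x0|xn0] := posnP (x i).
    (* A zero coefficient has no valuation; the exponent [l i] serves, since [q ^ l i] kills
       [e i]. *)
    exists (l i, 1%N); rewrite leqnn coprime1n; split=> //.
    by rewrite x0 mulr1n el.
  have xlt : (x i < q ^ l i)%N by rewrite -[X in (_ < X)%N]predK ltn_ord.
  have [u cu uE] := pfactor_coprime hq xn0.
  exists (logn q (x i), u); split; rewrite //= 1?coprime_sym //.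
    rewrite -(leq_exp2l _ _ (prime_gt1 hq)); apply: leq_trans (ltnW xlt).
    by rewrite dvdn_leq ?pfactor_dvdnn.
  by rewrite -mulrnA -uE.
have [f fP] := fin_all_exists H.
exists (fun i => e i *+ (f i).2), (fun i => (f i).1).
split; [split | by move=> i; case: (fP i) |].
- by move=> i; rewrite mulrnAC el mul0rn.
- move=> S clS Se; apply: span => // i.
  have cop : coprime (f i).2 (q ^ l i) by rewrite coprimeXr //; case: (fP i).
  (* By Euler's theorem this power inverts [(f i).2] modulo [q ^ l i], which recovers [e i] from its
     multiple. *)
  have := closedMn clS ((f i).2 ^ (totient (q ^ l i)).-1)%N (Se i).
  rewrite -mulrnA -expnS prednK ?totient_gt0 ?expn_gt0 ?q_gt0 //.
  by rewrite -(mulrn_modn _ (el i)) Euler_exp_totient // mulrn_modn.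
rewrite -xE; apply: eq_bigr => i _; by case: (fP i).
Qed.

(* If [a i < a j] and [l j - a j < l i - a i], then replacing [e i] by
   [e i + (q ^ d - 1) q ^ s e j] for suitable [d] and [s] lowers [a j] and leaves
   the other exponents unchanged. *)
Lemma chain_gen_system l e a c :
  gen_system l e -> (forall i, (a i <= l i)%N) -> c = \sum_i e i *+ q ^ a i ->
  exists e' a', [/\ gen_system l e', forall i, (a' i <= l i)%N,
    c = \sum_i e' i *+ q ^ a' i &
    forall i j, (a' i < a' j)%N -> (l i - a' i <= l j - a' j)%N].
Proof.
have [K] := ubnP (\sum_i a i)%N.
elim: K e a => // K IH e a ltK [el span] al cE.
have [/existsP[i /existsP[j /andP[aij bij]]] | good] :=
  boolP [exists i, exists j, (a i < a j)%N && (l j - a j < l i - a i)%N]; last first.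
  exists e, a; split=> // i j aij; rewrite leqNgt; apply: contra good => bij.
  by apply/existsP; exists i; apply/existsP; exists j; rewrite aij.
have ij : j != i by apply/eqP => E; move: aij; rewrite E ltnn.
(* The least new exponent for [e j] such that [t - a i] is a genuine difference and [q ^ l i] still
   kills the new [e i]. In the notation above, [d = a j - t] and [s = t - a i]. *)
pose t := maxn (a i) (l j - (l i - a i)).
have [ali alj] : (a i <= l i)%N /\ (a j <= l j)%N by [].
have tlt : (t < a j)%N by rewrite /t; lia.
pose w := ((q ^ (a j - t)).-1 * q ^ (t - a i))%N.
pose e' k := if k == i then e i + e j *+ w else e k.
pose a' k := if k == j then t else a k.
apply: (IH e' a').
- rewrite ltnS in ltK; apply: leq_trans ltK.
  rewrite (bigD1 j) //= [X in (_ < X)%N](bigD1 j) //=.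
  rewrite /a' eqxx -addSn leq_add //; apply: leq_sum => k /negPf kj.
  by rewrite kj.
- split=> [k | S clS Se].
    rewrite /e'; case: eqP => // ->; rewrite mulrnDl el add0r -mulrnA.
    have -> : (w * q ^ l i = q ^ l j *
        ((q ^ (a j - t)).-1 * q ^ (t - a i + l i - l j)))%N.
      rewrite /w -mulnA -expnD [RHS]mulnCA -expnD; congr (_ * _ ^ _)%N.
      by rewrite /t; lia.
    by rewrite mulrnA el mul0rn.
  have Sj : e j \in S by have := Se j; rewrite /e' (negPf ij).
  apply: span => // k; have := Se k; rewrite /e'; case: eqP => // -> Sk.
  by rewrite -(addrK (e j *+ w) (e i)); apply: closedB => //; apply: closedMn.
- by move=> k; rewrite /a'; case: eqP => // ->; lia.
rewrite cE (bigD1 i) //= [RHS](bigD1 i) //= (bigD1 j) //= [X in _ = _ + X](bigD1 j) //=.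
rewrite !addrA; congr (_ + _); last first.
  apply: eq_bigr => k /andP[/negPf ki /negPf kj].
  by rewrite /e' /a' ki kj.
rewrite /e' /a' !eqxx (negPf ij) eq_sym (negPf ij) mulrnDl -addrA; congr (_ + _).
(* The coefficient of [e j] is now [(q ^ (a j - t) - 1) q ^ t + q ^ t = q ^ a j], as before. *)
rewrite -mulrnA -mulrnDr; congr (_ *+ _).
rewrite /w -mulnA -expnD (_ : t - a i + a i = t)%N; last by rewrite /t; lia.
by rewrite -mulSnr predK -expnD; congr (_ ^ _)%N; lia.
Qed.

Lemma sort_gen_system l e a c :
  gen_system l e -> (forall i, (a i <= l i)%N) -> c = \sum_i e i *+ q ^ a i ->
  (forall i j, (a i < a j)%N -> (l i - a i <= l j - a j)%N) ->
  exists (mu nu : {ffun 'I_n -> nat}) e', [/\ gen_system (fun i => mu i + nu i)%N e',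
    nonincr mu /\ nonincr nu, (\sum_i (mu i + nu i) = \sum_i l i)%N
    & c = \sum_i e' i *+ q ^ nu i].
Proof.
move=> [el span] al cE chain.
(* The chain hypothesis makes this product order total, so a single sort renders both coordinates
   nonincreasing. *)
pose r i j := (a j <= a i)%N && (l j - a j <= l i - a i)%N.
have r_tr : transitive r by move=> j i k; rewrite /r; lia.
have r_refl : reflexive r by move=> i; rewrite /r !leqnn.
have r_tot : total r.
  by move=> i j; rewrite /r; have := chain i j; have := chain j i; lia.
pose s := sort r (enum 'I_n).
have sz : size s = n by rewrite size_sort size_enum_ord.
have us : uniq s by rewrite sort_uniq enum_uniq.
pose f i : 'I_n := nth i s i.
have fr (i j : 'I_n) : (i <= j)%N -> r (f i) (f j).
  move=> ij; rewrite /f (set_nth_default i) ?sz //.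
  apply: (sorted_leq_nth r_tr r_refl) => //; rewrite ?inE ?sz //.
  exact: sort_sorted.
have f_inj : injective f.
  move=> i j /eqP; rewrite /f (set_nth_default i j) ?sz // nth_uniq ?sz // => /eqP.
  exact: ord_inj.
have flE i : (l (f i) - a (f i) + a (f i) = l (f i))%N by rewrite subnK.
exists [ffun i => l (f i) - a (f i)]%N, [ffun i => a (f i)], (fun i => e (f i)).
split.
- split=> [i | S clS Se]; first by rewrite !ffunE flE.
  by apply: span => // i; have [j _ ->] : exists2 j, true & i = f j by
    exists (invF f_inj i) => //; rewrite f_invF.
- by split=> i j /fr /andP[]; rewrite !ffunE.
- by rewrite [RHS](reindex_inj f_inj) /=; apply: eq_bigr => i _; rewrite !ffunE flE.
- by rewrite cE (reindex_inj f_inj); apply: eq_bigr => i _; rewrite ffunE.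
Qed.

(** The structure theorem gives nontrivial cyclic factors whose exponents sum to [n], hence at most
    [n] of them. The family is padded to length [n] with generators [0], of order 1 and exponent
    0. *)
Lemma exists_gen_system : #|A| = (q ^ n)%N ->
  exists l e, gen_system l e /\ (\sum_i l i = n)%N.
Proof.
move=> cardA.
have [b bG bt] := abelian_structure (FinRing.zmod_abelian [set: A]).
have ord_dvd (x : A) : (#[x]%g = q ^ logn q #[x]%g)%N.
  have : (#[x]%g %| q ^ n)%N by rewrite -cardA -cardsT order_dvdG // inE.
  by case/(dvdn_pfactor _ _ hq) => m _ ->; rewrite pfactorK.
have sumb : (\sum_(x <- b) logn q #[x]%g = n)%N.
  apply/eqP; rewrite -(eqn_exp2l _ _ (prime_gt1 hq)) expn_sum -cardA -cardsT.
  by rewrite -(bigdprod_card bG); apply/eqP/eq_bigr => x _; rewrite -ord_dvd.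
have szb : (size b <= n)%N.
  rewrite -sumb -sum1_size !big_seq; apply: leq_sum => x bx.
  rewrite lt0n; apply/eqP => lx.
  have : (1 < #[x]%g)%N.
    by apply: (allP (abelian_type_gt1 [set: A])); rewrite -bt map_f.
  by rewrite ord_dvd lx.
exists (fun i => logn q #[nth 0 b i]%g), (fun i => nth 0 b i); split; [split|].
- move=> i; rewrite -ord_dvd -FinRing.zmodXgE; exact: expg_order.
- move=> S clS Se x.
  have gS : group_set S.
    apply/group_setP; split; first by case: clS.
    by move=> y z Sy Sz; rewrite FinRing.zmodMgE; apply: closedD.
  suff /subsetP/(_ x) : [set: A] \subset Group gS by rewrite inE; apply.
  rewrite -(bigdprodWY bG) gen_subG bigcup_seq; apply/bigcupsP => y yb.
  rewrite cycle_subG /=.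
  have yi : (index y b < n)%N by apply: leq_trans szb; rewrite index_mem.
  by have := Se (Ordinal yi); rewrite /= nth_index.
rewrite -[RHS]sumb (big_nth 0) big_mkord.
rewrite (big_ord_widen _ (fun i => logn q #[nth 0 b i]%g) szb) [RHS]big_mkcond.
apply: eq_bigr => i _; case: ltnP => // ib.
by rewrite nth_default // (order1 A) logn1.
Qed.

Lemma bipart_group_surj (c : A) : #|A| = (q ^ n)%N ->
  exists mu nu : {ffun 'I_n -> nat}, [/\ nonincr mu, nonincr nu,
    (\sum_i (mu i + nu i) = n)%N &
    pointed_iso (PointedGroup c) (bipart_group q mu nu)].
Proof.
move=> cardA; have [l [e [gen suml]]] := exists_gen_system cardA.
have [e1 [a1 [gen1 al1 cE1]]] := scale_gen_system c gen.
have [e2 [a2 [gen2 al2 cE2 chain]]] := chain_gen_system gen1 al1 cE1.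
have [mu [nu [e3 [gen3 [dmu dnu] sumE cE]]]] := sort_gen_system gen2 al2 cE2 chain.
exists mu, nu; split; rewrite ?sumE //.
by apply: gen_system_iso gen3 cE; rewrite sumE suml.
Qed.

End Generators.

(** * Partitions as nonincreasing sequences *)

(** Forgetting the tuple type puts partitions of different integers in one type; the padding zeros
    are kept, so the length is [m]. *)
Definition parts m : seq (seq nat) :=
  [seq map val (tval s) | s : m.-tuple 'I_m.+1 in
    [set s : m.-tuple 'I_m.+1 | sorted geq (map val s) && (sumn (map val s) == m)]].

Lemma size_parts m : size (parts m) = npartitions m.
Proof. by rewrite size_map -cardE. Qed.

Lemma parts_uniq m : uniq (parts m).
Proof.
rewrite map_inj_uniq ?enum_uniq // => s t /(inj_map val_inj); exact: val_inj.
Qed.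

Lemma mem_parts m s :
  (s \in parts m) = [&& size s == m, sorted geq s & sumn s == m].
Proof.
apply/mapP/and3P => [[t] | [/eqP sz srt /eqP sm]].
  by rewrite mem_enum inE => /andP[srt sm] ->; rewrite size_map size_tuple.
have sE : map val (map (@inord m) s) = s.
  rewrite -map_comp -[RHS]map_id; apply/eq_in_map => x xs /=.
  by rewrite inordK // ltnS -sm; elim: s xs {sz srt sm} => //= y s IH;
     rewrite inE => /predU1P[->|/IH]; lia.
have sz' : size (map (@inord m) s) == m by rewrite size_map sz.
exists (Tuple sz'); last by rewrite /= sE.
by rewrite mem_enum inE /= sE srt sm /=.
Qed.

Lemma sum_nth_sumn n s : (size s <= n)%N -> (\sum_(i < n) nth 0 s i = sumn s)%N.
Proof.
move=> sz; rewrite sumnE (big_nth 0%N) big_mkord.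
rewrite (big_ord_widen _ (nth 0%N s) sz).
rewrite [RHS]big_mkcond; apply: eq_bigr => i _.
by case: ltnP => // ib; rewrite nth_default.
Qed.

Definition nthf n (s : seq nat) : {ffun 'I_n -> nat} := [ffun i : 'I_n => nth 0%N s i].

Lemma nthf_inj n m m' s s' : (m <= n)%N -> (m' <= n)%N ->
  s \in parts m -> s' \in parts m' -> nthf n s = nthf n s' -> s = s'.
Proof.
move=> mn mn'; rewrite !mem_parts => /and3P[/eqP sz _ /eqP sm].
case/and3P=> [/eqP sz' _ /eqP sm'] /ffunP E.
have {}E (i : 'I_n) : nth 0%N s i = nth 0%N s' i by have := E i; rewrite !ffunE.
(* The sum of the entries recovers [m], hence the length of the padded sequence. *)
have mm' : m = m'.
  by rewrite -sm -sm' -!(@sum_nth_sumn n) ?sz ?sz' //; apply: eq_bigr.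
apply: (@eq_from_nth _ 0%N) => [|i]; rewrite sz ?sz' // => im.
exact: E (Ordinal (leq_trans im mn)).
Qed.

Lemma nonincr_nthf n m s : s \in parts m -> nonincr (nthf n s).
Proof.
rewrite mem_parts => /and3P[_ srt _] i j ij; rewrite !ffunE.
have [jb|jb] := ltnP j (size s); last by rewrite (nth_default _ jb).
apply: (sorted_leq_nth (rev_trans leq_trans) leqnn) => //.
by rewrite inE; apply: leq_ltn_trans jb.
Qed.

Lemma nonincr_parts n (mu : {ffun 'I_n -> nat}) : nonincr mu -> (\sum_i mu i <= n)%N ->
  exists2 s, s \in parts (\sum_i mu i)%N & mu = nthf n s.
Proof.
move=> dmu; set m := (\sum_i mu i)%N => mn.
(* A positive entry at [i] would make the first [i + 1] entries positive and the sum larger than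
   [i]. Truncating to length [m] therefore drops only zeros. *)
have mu0 (i : 'I_n) : (m <= i)%N -> mu i = 0%N.
  move=> mi; apply/eqP; rewrite -leqn0 leqNgt; apply/negP => mui.
  suff : (i < m)%N by rewrite ltnNge mi.
  rewrite -[i.+1]card_ord -sum1_card (big_ord_widen n (fun=> 1%N)) // big_mkcond.
  apply: leq_sum => j _; case: ltnP => // ji; exact: leq_trans mui (dmu _ _ ji).
pose g k := oapp mu 0%N (insub k).
have gE (i : 'I_n) : g i = mu i by rewrite /g valK.
have dg i j : (i <= j)%N -> (g j <= g i)%N.
  move=> ij; rewrite {1}/g; case: insubP => //= j' jn jE.
  by rewrite -[X in g X]/(val (Ordinal (leq_ltn_trans ij jn))) gE dmu //= jE.
have muE : mu = nthf n (mkseq g m).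
  apply/ffunP => i; rewrite ffunE; have [im|im] := ltnP i m.
    by rewrite nth_mkseq // gE.
  by rewrite nth_default ?size_mkseq // mu0.
exists (mkseq g m) => //; rewrite mem_parts size_mkseq eqxx /=; apply/andP; split.
  apply/(sortedP 0%N) => i; rewrite size_mkseq => im.
  by rewrite !nth_mkseq ?(ltnW im) //; apply: dg.
rewrite -(@sum_nth_sumn n) ?size_mkseq //; apply/eqP.
by apply: eq_bigr => i _; rewrite [in RHS]muE ffunE.
Qed.

(** * Counting pairs of partitions *)

Definition bipartitions n : seq (seq nat * seq nat) :=
  [seq st | m <- iota 0 n.+1, st <- [seq (s, t) | s <- parts m, t <- parts (n - m)]].

Lemma size_bipartitions n :
  size (bipartitions n) = (\sum_(0 <= m < n.+1) npartitions m * npartitions (n - m))%N.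
Proof.
rewrite size_allpairs_dep sumnE big_map /index_iota subn0.
by apply: eq_bigr => m _; rewrite size_allpairs !size_parts.
Qed.

Lemma mem_bipartitions n s t :
  reflect (exists2 m, (m <= n)%N & s \in parts m /\ t \in parts (n - m))
          ((s, t) \in bipartitions n).
Proof.
apply: (iffP allpairsPdep) => [[m [p [mn pin pE]]] | [m mn [sm tm]]].
  move: pin; rewrite -pE => /allpairsP[[s' t'] /= [sm tm [-> ->]]].
  by exists m => //; move: mn; rewrite mem_iota ltnS.
exists m, (s, t); rewrite mem_iota ltnS; split=> //.
by apply/allpairsP; exists (s, t).
Qed.

Lemma bipartitions_uniq n : uniq (bipartitions n).
Proof.
apply: allpairs_uniq_dep => [|m _|]; first exact: iota_uniq.
  by apply: allpairs_uniq; rewrite ?parts_uniq // => -[? ?] [? ?].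
move=> _ _ /allpairsPdep[m [st [_ H ->]]] /allpairsPdep[m' [st' [_ H' ->]]] /= E.
(* The index [m] can be read off the pair, as the length of its first component. *)
suff mm' : m = m' by rewrite -mm' E.
move: H H'; rewrite -E => /allpairsP[[s t] [sm _ ->]] /allpairsP[[s' t'] [sm' _ [E' _]]].
by move: sm sm' => /=; rewrite -E' !mem_parts => /and3P[/eqP-> _ _] /and3P[/eqP].
Qed.

(* "The number of isomorphism classes of pointed abelian groups of order q^n
   is N": there is a family of N pointed groups of order q^n, pairwise
   non-isomorphic, such that every pointed abelian group of order q^n is
   isomorphic to one of them. *)
Theorem theorem3p1 (q n : nat) (hq : prime q) :
  let N := (\sum_(0 <= m < n.+1) npartitions m * npartitions (n - m))%N in
  exists P : 'I_N -> pointed_group,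
    (forall i, #|pg_carrier (P i)| = q ^ n)%N /\
    (forall i j, pointed_iso (P i) (P j) -> i = j) /\
    (forall (A : finZmodType) (c : A), #|A| = (q ^ n)%N ->
       exists i, pointed_iso (PointedGroup c) (P i)).
Proof.
move=> N; pose st (i : 'I_N) := nth ([::], [::]) (bipartitions n) i.
have st_in i : st i \in bipartitions n by rewrite mem_nth // size_bipartitions.
exists (fun i => bipart_group q (nthf n (st i).1) (nthf n (st i).2)).
split=> [i | ].
  have := st_in i; case: (st i) => s t /mem_bipartitions[m mn [sm tm]] /=.
  have [tn ntn] : (n - m <= n /\ m + (n - m) = n)%N by lia.
  rewrite (card_bipart_group hq) big_split /=; congr (_ ^ _)%N.
  under eq_bigr do rewrite ffunE; under [X in (_ + X)%N]eq_bigr do rewrite ffunE.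
  move: sm tm; rewrite !mem_parts => /and3P[/eqP sz _ /eqP sm] /and3P[/eqP tz _ /eqP tm].
  by rewrite !sum_nth_sumn ?sz ?tz // sm tm.
split=> [i j | A c cardA].
  (* The list has no repetition, so it suffices that isomorphic groups come from equal pairs. *)
  move=> iso; apply: ord_inj; apply/eqP.
  rewrite -(nth_uniq ([::], [::]) _ _ (bipartitions_uniq n)) ?size_bipartitions //.
  rewrite -/(st i) -/(st j); move: iso (st_in i) (st_in j).
  case: (st i) (st j) => s t [s' t'] /= iso.
  move=> /mem_bipartitions[m mn [sm tm]] /mem_bipartitions[m' mn' [sm' tm']].
  have [Es Et] := bipart_group_inj hq (nonincr_nthf sm) (nonincr_nthf tm)
    (nonincr_nthf sm') (nonincr_nthf tm') iso.
  move/ffunP/(nthf_inj mn mn' sm sm'): Es => ->.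
  by move/ffunP/(nthf_inj (leq_subr _ _) (leq_subr _ _) tm tm'): Et => ->.
have [mu [nu [dmu dnu sumE iso]]] := bipart_group_surj hq c cardA.
rewrite big_split /= in sumE.
have mu_n : (\sum_i mu i <= n)%N by rewrite -[X in (_ <= X)%N]sumE leq_addr.
have nu_n : (n - \sum_i mu i = \sum_i nu i)%N by rewrite -[X in (X - _)%N]sumE addKn.
have [s sm muE] := nonincr_parts dmu mu_n.
have [|t tn nuE] := nonincr_parts dnu; first by rewrite -nu_n leq_subr.
have st_mem : (s, t) \in bipartitions n.
  by apply/mem_bipartitions; exists (\sum_i mu i)%N; rewrite ?nu_n.
have idx : (index (s, t) (bipartitions n) < N)%N.
  by rewrite /N -size_bipartitions index_mem.
by exists (Ordinal idx); rewrite /st /= nth_index //= -muE -nuE.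
Qed.
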